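(* Let $a>0$. For an eigenvalue $\lambda=\lambda_R+\mathrm{i}\lambda_I\in\mathbb{C}$ of the mesh eigenvalue problem $-\Lambda e=\lambda s_Ne$ on $\omega_h$, $e\in H_h$, $e\not\equiv 0$ (on some mesh $\bar\omega_h$ on $[0,X]$) and $\tau>0$ with $\alpha:=\frac1{12}\tau^2a^2\lambda\neq -1$, put $\mu=\frac{1-5\alpha}{1+\alpha}$ and let $q$ be a root of the characteristic equation $q^2-2\mu q+1=0$ (its roots are $q$ and $1/q$) with $|q|\geq 1$. 1. The following asymptotic formula holds: $$|q|=1+\varkappa_0\tau+O(\tau^2|\lambda|)\quad\text{as }\tau^2|\lambda|\to 0,\qquad \varkappa_0=\varkappa_0(\lambda):=\frac{a}{\sqrt2}\sqrt{|\lambda|-\lambda_R},$$ where the constant in the $O$-term depends only on $a$. 2. Let $\varkappa\geq 0$. For the validity, with some constant $C>0$, of the stability bound $$\|v^m\|_h\leq C(1+\varkappa\tau)^m\big(\|v^0\|_h+\|u_{1N}\|_{1h}\big)\quad\text{for any } v^0,u_{1N}\in H_h,\ m\geq 0,$$ for the solutions $v$ of the compact scheme (described in the context) with data $v^0,u_{1N}$, where $\|\cdot\|_h$ and $\|\cdot\|_{1h}$ are any fixed norms on $H_h$, the following conditions are necessary: $$\frac16a^2\tau^2\max\{|\lambda_R|,2|\lambda_I|\}\leq 1+O(\tau),\qquad a^2|\lambda_I|\tau\leq\frac92\varkappa+O(\tau)\quad\text{as }\tau\to 0,$$ where the $O(\tau)$ terms depend only on $\varkappa$ and $\tau$ (not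 on the mesh, $\lambda$, $C$ or the norms).
   Context: Mesh and operators. Let $X>0$, $N\geq 2$, and let $\bar\omega_h$ be a (generally non-uniform) mesh on $[0,X]$ with nodes $0=x_0<\dots<x_N=X$ and steps $h_j=x_j-x_{j-1}$, $1\le j\le N$; $\omega_h=\{x_j\}_{j=1}^{N-1}$. Let $H_h$ be the complex vector space of functions $w:\bar\omega_h\to\mathbb{C}$, $w_j=w(x_j)$, with $w_0=w_N=0$. For $1\leq j\leq N-1$ put $\hat h_j=\frac{h_j+h_{j+1}}{2}$ and $$(\Lambda w)_j=\frac{1}{\hat h_j}\Big(\frac{w_{j+1}-w_j}{h_{j+1}}-\frac{w_j-w_{j-1}}{h_j}\Big),\qquad (s_Nw)_j=\frac1{12}\big(\alpha_{hj}w_{j-1}+10\gamma_{hj}w_j+\beta_{hj}w_{j+1}\big),$$ $$\alpha_{hj}=2-\frac{h_{j+1}^2}{h_j\hat h_j},\qquad \gamma_{hj}=1+\frac{(h_{j+1}-h_j)^2}{5h_jh_{j+1}},\qquad \beta_{hj}=2-\frac{h_j^2}{h_{j+1}\hat h_j}.$$ Scheme. Let $a>0$, $\tau>0$, $\sigma=\frac1{12}$. For given data $v^0\in H_h$ and $u_{1N}\in H_h$ (treated as arbitrary data), a solution is a sequence $v^m\in H_h$, $m\geq 0$, starting with the given $v^0$, such that $$(s_N-\sigma\tau^2a^2\Lambda)\frac{v^{m+1}-2v^m+v^{m-1}}{\tau^2}-a^2\Lambda v^m=0\ \text{ on }\omega_h,\ m\geq 1,$$ $$(s_N-\sigma\tau^2a^2\Lambda)\frac{v^1-v^0}{\tau}-\frac{\tau}{2}a^2\Lambda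 v^0=u_{1N}\ \text{ on }\omega_h.$$ *)

(* Defs.v *)
From HB Require Import structures.
From mathcomp Require Import all_boot all_order all_algebra.
From mathcomp Require Import reals.
From mathcomp.real_closed Require Import complex.

Set Implicit Arguments.
Unset Strict Implicit.
Unset Printing Implicit Defensive.

Import Order.TTheory GRing.Theory Num.Theory.

Local Open Scope ring_scope.
Local Open Scope complex_scope.

(* The library norm `|z| on R[i] takes its values in R[i]; the modulus below is
   the same number as an element of R. *)
Notation modulus := ComplexField.Normc.normc.

Section CompactScheme.
Variable R : realType.

(* Only the values x 0, ..., x N matter; the sequence is arbitrary beyond N. *)
Definition is_mesh (X : R) (N : nat) (x : nat -> R) : Prop :=
  [/\ (2 <= N)%N, x 0%N = 0, x N = X
    & forall j, (j < N)%N -> x j < x j.+1].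

Section Operators.
Variables (N : nat) (x : nat -> R).

Definition step (j : nat) : R := x j - x j.-1.
Definition hstep (j : nat) : R := (step j + step j.+1) / 2.

(* A complex function on the closed mesh is a row vector of length N + 1. *)
Definition gval (w : 'rV[R[i]]_N.+1) (j : nat) : R[i] := w 0 (inord j).

Definition in_H (w : 'rV[R[i]]_N.+1) : Prop := gval w 0 = 0 /\ gval w N = 0.

Definition interior (j : nat) : bool := (1 <= j < N)%N.

(* The two operators below are meaningful at interior j only. *)
Definition Lambda (w : 'rV[R[i]]_N.+1) (j : nat) : R[i] :=
  (hstep j)^-1%:C *
  ((gval w j.+1 - gval w j) / (step j.+1)%:C
   - (gval w j - gval w j.-1) / (step j)%:C).

Definition alphah (j : nat) : R := 2 - step j.+1 ^+ 2 / (step j * hstep j).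
Definition gammah (j : nat) : R :=
  1 + (step j.+1 - step j) ^+ 2 / (5 * step j * step j.+1).
Definition betah (j : nat) : R := 2 - step j ^+ 2 / (step j.+1 * hstep j).

Definition sN (w : 'rV[R[i]]_N.+1) (j : nat) : R[i] :=
  (12^-1 : R)%:C *
  ((alphah j)%:C * gval w j.-1 + (10 * gammah j)%:C * gval w j
   + (betah j)%:C * gval w j.+1).

Definition mesh_eigenvalue (lambda : R[i]) : Prop :=
  exists e : 'rV[R[i]]_N.+1,
    [/\ in_H e, e <> 0
      & forall j, interior j -> - Lambda e j = lambda * sN e j].

Variables (a tau : R).

Definition sigma : R := 12^-1.

Definition implicit_op (w : 'rV[R[i]]_N.+1) (j : nat) : R[i] :=
  sN w j - (sigma * tau ^+ 2 * a ^+ 2)%:C * Lambda w j.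

Definition is_solution (v0 u1 : 'rV[R[i]]_N.+1) (v : nat -> 'rV[R[i]]_N.+1)
    : Prop :=
  [/\ forall m, in_H (v m),
      v 0%N = v0,
      forall m, (1 <= m)%N -> forall j, interior j ->
        implicit_op ((tau ^+ 2)^-1%:C *: (v m.+1 - 2 *: v m + v m.-1)) j
        - (a ^+ 2)%:C * Lambda (v m) j = 0
    & forall j, interior j ->
        implicit_op (tau^-1%:C *: (v 1%N - v 0%N)) j
        - (tau / 2 * a ^+ 2)%:C * Lambda (v 0%N) j = gval u1 j].

(* Norms on the complex vector space H_h; nothing is required outside H_h. *)
Definition is_norm (nrm : 'rV[R[i]]_N.+1 -> R) : Prop :=
  [/\ forall w, in_H w -> 0 <= nrm w,
      forall w, in_H w -> nrm w = 0 -> w = 0,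
      forall (c : R[i]) w, in_H w -> nrm (c *: w) = modulus c * nrm w
    & forall w1 w2, in_H w1 -> in_H w2 -> nrm (w1 + w2) <= nrm w1 + nrm w2].

Definition stability_bound (kappa : R) (nrm nrm1 : 'rV[R[i]]_N.+1 -> R)
    (C : R) : Prop :=
  forall (v0 u1 : 'rV[R[i]]_N.+1) (v : nat -> 'rV[R[i]]_N.+1),
    in_H v0 -> in_H u1 -> is_solution v0 u1 v ->
    forall m, nrm (v m) <= C * (1 + kappa * tau) ^+ m * (nrm v0 + nrm1 u1).

End Operators.

Definition alpha (a tau : R) (lambda : R[i]) : R[i] :=
  (12^-1 * tau ^+ 2 * a ^+ 2)%:C * lambda.

Definition mu (a tau : R) (lambda : R[i]) : R[i] :=
  (1 - 5 * alpha a tau lambda) / (1 + alpha a tau lambda).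

Definition char_root (a tau : R) (lambda q : R[i]) : Prop :=
  q ^+ 2 - 2 * mu a tau lambda * q + 1 = 0.

Definition kappa0 (a : R) (lambda : R[i]) : R :=
  a / Num.sqrt 2 * Num.sqrt (modulus lambda - complex.Re lambda).

End CompactScheme.

Arguments mesh_eigenvalue {R} N x lambda.
Arguments is_norm {R N} nrm.
Arguments stability_bound {R N} x a tau kappa nrm nrm1 C.

(* Main.v *)
Require Import Defs.
From HB Require Import structures.
From mathcomp Require Import all_boot all_order all_algebra.
From mathcomp Require Import reals ring lra.
From mathcomp.real_closed Require Import complex.

Set Implicit Arguments.
Unset Strict Implicit.
Unset Printing Implicit Defensive.

Import Order.TTheory GRing.Theory Num.Theory.

Local Open Scope ring_scope.
Local Open Scope complex_scope.

(* Since q + 1/q = 2 mu, an eigenvector e gives the separated solution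
   v^m = q^m e for suitable data, so the stability bound forces
   |q| <= 1 + kappa tau.
   From (q - 1)^2 = 2 (mu - 1) q and (q + 1)^2 = 2 (mu + 1) q one gets
   |q| + 1/|q| = |mu - 1| + |mu + 1|, so (|q| - 1)^2 / |q| equals
   6 (|alpha| - Re alpha) = (kappa0 tau)^2 up to O(|alpha|^2); taking square
   roots gives the expansion of |q|.
   Conversely |q| <= 1 + kappa tau confines mu to a thin ellipse around
   [-1, 1]; the bounds on lambda are read off alpha = (1 - mu) / (5 + mu), the
   constant 9/2 coming from |5 + mu| >= 4 - (kappa tau)^2 / 2. *)

(** * The modulus of a complex number as a real number *)

Section ComplexModulus.
Variable R : realType.
Implicit Types (z w : R[i]) (c : R).

Lemma modulus_ge0 z : 0 <= modulus z.
Proof. by case: z => u v; exact: sqrtr_ge0. Qed.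

Lemma sqr_modulus z :
  modulus z ^+ 2 = complex.Re z ^+ 2 + complex.Im z ^+ 2.
Proof. by case: z => u v /=; rewrite sqr_sqrtr // addr_ge0 ?sqr_ge0. Qed.

Lemma modulusX z n : modulus (z ^+ n) = modulus z ^+ n.
Proof.
elim: n => [|n IHn]; first by rewrite !expr0 ComplexField.Normc.normc1.
by rewrite !exprS ComplexField.Normc.normcM IHn.
Qed.

Lemma modulus_real c : modulus c%:C = `|c|.
Proof. by rewrite /= expr0n addr0 sqrtr_sqr. Qed.

Lemma modulus_natr n : modulus (n%:R : R[i]) = n%:R.
Proof. by rewrite -(rmorph_nat (real_complex R)) modulus_real ger0_norm. Qed.

Lemma normRe_le_modulus z : `|complex.Re z| <= modulus z.
Proof.
rewrite -(ler_pXn2r (ltn0Sn 1)) ?nnegrE ?modulus_ge0 //.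
by rewrite real_normK ?num_real // sqr_modulus lerDl sqr_ge0.
Qed.

Lemma normIm_le_modulus z : `|complex.Im z| <= modulus z.
Proof.
rewrite -(ler_pXn2r (ltn0Sn 1)) ?nnegrE ?modulus_ge0 //.
by rewrite real_normK ?num_real // sqr_modulus lerDr sqr_ge0.
Qed.

Lemma modulus_le_add z w : modulus (z + w) <= modulus z + modulus w.
Proof. exact: le_normcD. Qed.

Lemma modulusN z : modulus (- z) = modulus z.
Proof. exact: normcN. Qed.

End ComplexModulus.

(** * Comparison of geometric growth rates *)

Section Geometric.
Variable R : realType.

Lemma bernoulli (y : R) (m : nat) : 0 <= y -> 1 + m%:R * y <= (1 + y) ^+ m.
Proof.
move=> y0; elim: m => [|m IHm]; first by rewrite expr0 mul0r addr0.
rewrite exprS; apply: (@le_trans _ _ ((1 + y) * (1 + m%:R * y))).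
  have : 0 <= m%:R * (y * y) by rewrite !mulr_ge0.
  by rewrite -natr1; lra.
by rewrite ler_wpM2l // addr_ge0.
Qed.

(** If [r] exceeded [s], Bernoulli's inequality would make [(r / s) ^+ m] grow at least linearly in
    [m], against the bound [B / b]. *)
Lemma geometric_rate_le (r s b B : R) : 0 < s -> 0 < b ->
  (forall m, r ^+ m * b <= B * s ^+ m) -> r <= s.
Proof.
move=> s0 b0 H; rewrite leNgt; apply/negP => sr.
pose y := r / s - 1.
have y0 : 0 < y by rewrite subr_gt0 ltr_pdivlMr // mul1r.
have rE : r = (1 + y) * s by rewrite /y addrC subrK divfK ?gt_eqF.
have bnd m : m%:R * (y * b) <= B.
  have := H m; rewrite {1}rE exprMn mulrAC ler_pM2r ?exprn_gt0 // => Hm.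
  apply: le_trans Hm; rewrite mulrA ler_pM2r //.
  by apply: le_trans (bernoulli m (ltW y0)); rewrite lerDr.
have yb0 : 0 < y * b by rewrite mulr_gt0.
have := archi_boundP (normr_ge0 (B / (y * b))).
set m := Num.bound _ => Hm.
have := bnd m; rewrite -ler_pdivlMr // => Hm2.
have := le_lt_trans (le_trans Hm2 (ler_norm _)) Hm.
by rewrite ltxx.
Qed.

End Geometric.

(** * Separation of variables in the compact scheme *)

Section Separation.
Variables (R : realType) (N : nat) (x : nat -> R).
Implicit Types (e : 'rV[R[i]]_N.+1) (c : R[i]).

Lemma gvalZ c e j : gval (c *: e) j = c * gval e j.
Proof. by rewrite /gval mxE. Qed.

Lemma in_HZ c e : in_H e -> in_H (c *: e).
Proof. by move=> [e0 eN]; split; rewrite gvalZ ?e0 ?eN mulr0. Qed.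

Lemma LambdaZ c e j : Lambda x (c *: e) j = c * Lambda x e j.
Proof. by rewrite /Lambda !gvalZ; ring. Qed.

Lemma sNZ c e j : sN x (c *: e) j = c * sN x e j.
Proof. by rewrite /sN !gvalZ; ring. Qed.

Variables (a tau : R) (lambda : R[i]).

Lemma implicit_op_eigen c e j : - Lambda x e j = lambda * sN x e j ->
  implicit_op x a tau (c *: e) j = c * ((1 + alpha a tau lambda) * sN x e j).
Proof.
move=> ev; rewrite /implicit_op LambdaZ sNZ /alpha /sigma.
by rewrite -[Lambda _ _ _]opprK ev; ring.
Qed.

(** Denominator-free form, using [mu - 1 = - 6 * alpha / (1 + alpha)]; the three-level equation
    reduces to it on [q ^+ m *: e]. *)
Lemma char_rootE q : alpha a tau lambda <> -1 -> char_root a tau lambda q ->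
  (q ^+ 2 - 2 * q + 1) * (1 + alpha a tau lambda)
    = - 12 * alpha a tau lambda * q.
Proof.
rewrite /char_root /mu; set al := alpha _ _ _ => al1 h.
have al1' : 1 + al != 0 by rewrite addrC addr_eq0; apply/eqP.
have -> : q ^+ 2 = 2 * ((1 - 5 * al) / (1 + al)) * q - 1.
  by apply/eqP; rewrite -subr_eq0 -h; apply/eqP; ring.
by field.
Qed.

(** The [u_{1N}] that the initial equation forces for [v^0 = e], [v^1 = q e], extended by zero to
    the end nodes so that it lies in [H_h]. *)
Definition separated_data q e : 'rV[R[i]]_N.+1 :=
  \row_(j < N.+1) (if interior N j then
    implicit_op x a tau (tau^-1%:C *: (q *: e - e)) j
    - (tau / 2 * a ^+ 2)%:C * Lambda x e j else 0).

Lemma gval_separated_data q e j : (j <= N)%N ->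
  gval (separated_data q e) j =
    (if interior N j then
      implicit_op x a tau (tau^-1%:C *: (q *: e - e)) j
      - (tau / 2 * a ^+ 2)%:C * Lambda x e j else 0).
Proof. by move=> jN; rewrite /gval mxE inordK. Qed.

Lemma separated_data_in_H q e : in_H (separated_data q e).
Proof. by split; rewrite gval_separated_data // /interior ltnn ?andbF. Qed.

Lemma separated_solution q e : tau != 0 -> alpha a tau lambda <> -1 ->
  char_root a tau lambda q -> in_H e ->
  (forall j, interior N j -> - Lambda x e j = lambda * sN x e j) ->
  is_solution x a tau e (separated_data q e) (fun m => q ^+ m *: e).
Proof.
move=> tau0 al1 hq eH ev; split=> [m||[//|m] _ j ij|j ij].
- exact: in_HZ.
- by rewrite expr0 scale1r.
- rewrite !scalerA -scalerBl -scalerDl scalerA LambdaZ.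
  rewrite (implicit_op_eigen _ (ev _ ij)) -[Lambda _ _ _]opprK (ev _ ij).
  (* The middle level is [m.+1], so the lowest of the three levels carries [q ^+ m]. *)
  have qE : q ^+ m.+2 - 2 * q ^+ m.+1 + q ^+ m.+1.-1
      = q ^+ m * (q ^+ 2 - 2 * q + 1) by rewrite /= !exprS; ring.
  rewrite qE -mulrA [X in _ * X]mulrA -[X in _ * (X * _)]mulrA.
  rewrite (char_rootE al1 hq) /alpha.
  have tC : tau%:C != 0 by rewrite fmorph_eq0.
  have -> : (tau ^+ 2)^-1%:C = (tau%:C ^+ 2)^-1 by rewrite fmorphV rmorphXn.
  have -> : (12^-1 * tau ^+ 2 * a ^+ 2)%:C = 12^-1 * tau%:C ^+ 2 * (a ^+ 2)%:C.
    by rewrite -(rmorphXn (real_complex R)) 2!rmorphM fmorphV rmorph_nat.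
  rewrite (exprS q m); move: tau%:C (a ^+ 2)%:C tC => T A T0.
  by field.
- rewrite gval_separated_data ?ij; first by rewrite expr1 expr0 scale1r.
  by case/andP: ij => _ /ltnW.
Qed.

(** On the separated solution the stability bound compares [modulus q ^+ m] with
    [(1 + kappa * tau) ^+ m], up to factors independent of [m]. *)
Lemma char_root_le_growth q kappa (nrm nrm1 : 'rV[R[i]]_N.+1 -> R) C :
   0 < tau -> 0 <= kappa ->
  is_norm nrm -> stability_bound x a tau kappa nrm nrm1 C ->
  mesh_eigenvalue N x lambda -> alpha a tau lambda <> -1 ->
  char_root a tau lambda q -> modulus q <= 1 + kappa * tau.
Proof.
move=> tau0 k0 [nge0 ndef nhom _] stab [e [eH eN0 ev]] al1 hq.
have ne0 : 0 < nrm e.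
  rewrite lt_neqAle nge0 // andbT; apply/eqP => /esym /(ndef _ eH).
  exact: eN0.
apply: (@geometric_rate_le _ _ _ (nrm e)
  (C * (nrm e + nrm1 (separated_data q e)))) => // [|m].
  by rewrite ltr_wpDr // mulr_ge0 // ltW.
rewrite -modulusX -nhom // mulrAC; apply: (stab _ _ (fun m => q ^+ m *: e)) => //.
  exact: separated_data_in_H.
by apply: separated_solution => //; rewrite gt_eqF.
Qed.

End Separation.

(** * Roots of the characteristic equation *)

Section CharacteristicRoots.
Variables (R : realType) (a tau : R) (lambda : R[i]).

Lemma alpha_scale_ge0 : 0 <= 12^-1 * tau ^+ 2 * a ^+ 2.
Proof. by rewrite mulr_ge0 ?sqr_ge0 // mulr_ge0 ?sqr_ge0 ?invr_ge0. Qed.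

Lemma modulus_alpha :
  modulus (alpha a tau lambda) = 12^-1 * tau ^+ 2 * a ^+ 2 * modulus lambda.
Proof.
by rewrite ComplexField.Normc.normcM modulus_real (ger0_norm alpha_scale_ge0).
Qed.

(** The two roots have product 1, so they cannot both lie inside the unit disc. *)
Lemma char_root_exists :
  exists2 q, char_root a tau lambda q & 1 <= modulus q.
Proof.
pose m := mu a tau lambda; pose q := m + sqrtc (m ^+ 2 - 1).
have hq : char_root a tau lambda q.
  rewrite /char_root -/m.
  have -> : q ^+ 2 - 2 * m * q + 1 = sqrtc (m ^+ 2 - 1) ^+ 2 - (m ^+ 2 - 1).
    by rewrite /q; ring.
  by rewrite sqr_sqrtc subrr.
have [|q1] := leP 1 (modulus q); first by exists q.
have q0 : q != 0.
  apply/eqP => q0; move/eqP: hq; rewrite /char_root q0 expr0n mulr0 subr0 add0r.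
  by rewrite oner_eq0.
exists q^-1.
  rewrite /char_root; have -> : q^-1 ^+ 2 - 2 * mu a tau lambda * q^-1 + 1
    = (q ^+ 2 - 2 * mu a tau lambda * q + 1) / q ^+ 2 by field.
  by rewrite hq mul0r.
have mq0 : 0 < modulus q.
  rewrite lt_neqAle modulus_ge0 andbT eq_sym; apply: contraNneq q0.
  by move=> /ComplexField.Normc.eq0_normc ->.
by rewrite ComplexField.Normc.normcV invf_ge1 // ltW.
Qed.

(* Parallelogram identity for [(q - 1)^2 = 2 (mu - 1) q] and
   [(q + 1)^2 = 2 (mu + 1) q]. *)
Lemma char_root_modulusE q : alpha a tau lambda <> -1 ->
  char_root a tau lambda q ->
  (modulus q ^+ 2 + 1) * modulus (1 + alpha a tau lambda)
  = modulus q * (6 * modulus (alpha a tau lambda)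
                 + 2 * modulus (1 - 2 * alpha a tau lambda)).
Proof.
move=> al1 hq; have hm := char_rootE al1 hq.
set al := alpha _ _ _ in hm *.
(* The factors come from [mu - 1 = - 6 * al / (1 + al)] and, for [Ep],
   [mu + 1 = 2 * (1 - 2 * al) / (1 + al)]. *)
have Em : modulus (q - 1) ^+ 2 * modulus (1 + al) = 12 * modulus al * modulus q.
  rewrite -modulusX -ComplexField.Normc.normcM.
  have -> : (q - 1) ^+ 2 * (1 + al) = - (12%:R * al * q).
    have -> : (q - 1) ^+ 2 = q ^+ 2 - 2 * q + 1 by ring.
    by rewrite hm; ring.
  by rewrite modulusN !ComplexField.Normc.normcM modulus_natr.
have Ep : modulus (q + 1) ^+ 2 * modulus (1 + al)
    = 4 * modulus (1 - 2 * al) * modulus q.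
  rewrite -modulusX -ComplexField.Normc.normcM.
  have -> : (q + 1) ^+ 2 * (1 + al) = 4%:R * (1 - 2 * al) * q.
    have -> : (q + 1) ^+ 2 = (q ^+ 2 - 2 * q + 1) + 4 * q by ring.
    by rewrite mulrDl hm; ring.
  by rewrite !ComplexField.Normc.normcM modulus_natr.
have par : modulus (q - 1) ^+ 2 + modulus (q + 1) ^+ 2
    = 2 * (modulus q ^+ 2 + 1).
  by rewrite !sqr_modulus; case: (q) => u v /=; ring.
have : 2 * ((modulus q ^+ 2 + 1) * modulus (1 + al))
    = 2 * (modulus q * (6 * modulus al + 2 * modulus (1 - 2 * al))).
  by rewrite mulrA -par mulrDl Em Ep; ring.
by apply: mulfI; rewrite pnatr_eq0.
Qed.

End CharacteristicRoots.

(** * Expansion of the larger root modulus for small [alpha] *)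

Section Asymptotics.
Variable R : realType.

(** Since [|s - t| <= s + t], the square of [|s - t|] is at most [|s ^+ 2 - t ^+ 2|]. *)
Lemma root_dist_le (s t c : R) : 0 <= s -> 0 <= t -> 0 <= c ->
  `|s ^+ 2 - t ^+ 2| <= c ^+ 2 -> `|s - t| <= c.
Proof.
move=> s0 t0 c0; rewrite !ler_norml => /andP[h1 h2].
by apply/andP; split; nra.
Qed.

(** The excess times [modulus (1 + z) + 1 + Re z] equals [Im z ^+ 2], and that factor is at least 1
    when [Re z >= -1/2]. *)
Lemma modulus_excess (z : R[i]) : -1 / 2 <= complex.Re z ->
  0 <= modulus (1 + z) - (1 + complex.Re z) <= complex.Im z ^+ 2.
Proof.
move=> hz; have := sqr_modulus (1 + z); have := modulus_ge0 (1 + z).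
case: z hz => u v /= hu; set M := Num.sqrt _ => M0; rewrite add0r => ME.
by apply/andP; split; nra.
Qed.

(** With [n = |alpha|], the constant is 26 = 6 + 20: [|s - t| <= 6 n] and
    [0 <= |q| - 1 - s <= s ^+ 2 <= 20 n]. *)
Lemma char_root_modulus_asymptotic (a tau : R) (lambda q : R[i]) : 0 < a ->
  0 < tau -> alpha a tau lambda <> -1 -> char_root a tau lambda q ->
  1 <= modulus q -> modulus (alpha a tau lambda) <= 1 / 4 ->
  `|modulus q - (1 + kappa0 a lambda * tau)|
    <= 26 * modulus (alpha a tau lambda).
Proof.
move=> a0 tau0 al1 hq q1 small; have := char_root_modulusE al1 hq.
have tE : (kappa0 a lambda * tau) ^+ 2
    = 6 * (modulus (alpha a tau lambda) - complex.Re (alpha a tau lambda)).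
  have d0 : 0 <= modulus lambda - complex.Re lambda.
    by rewrite subr_ge0 (le_trans (ler_norm _)) // normRe_le_modulus.
  rewrite /kappa0 modulus_alpha /alpha.
  rewrite !exprMn exprVn !sqr_sqrtr //.
  by case: (lambda) => u v /=; field.
have k0 : 0 <= kappa0 a lambda * tau.
  by rewrite !mulr_ge0 ?invr_ge0 ?sqrtr_ge0 // ltW.
move: (kappa0 a lambda * tau) tE k0 => t tE t0.
move: (alpha a tau lambda) tE small {al1 hq} => al tE small key.
set n := modulus al in tE small key *.
have n0 : 0 <= n := modulus_ge0 _.
have nE : n ^+ 2 = complex.Re al ^+ 2 + complex.Im al ^+ 2 := sqr_modulus al.
have : `|complex.Re al| <= n := normRe_le_modulus al.
rewrite ler_norml => /andP[un un'].
(* The threshold 1/4 keeps the real parts of both [al] and [- 2 * al] at least -1/2. *)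
have /andP[D1 D2] : 0 <= modulus (1 + al) - (1 + complex.Re al)
    <= complex.Im al ^+ 2 by apply: modulus_excess; lra.
have /andP[W1 W2] : 0 <= modulus (1 - 2 * al) - (1 - 2 * complex.Re al)
    <= 4 * complex.Im al ^+ 2.
  have ReE : complex.Re (- (2 * al)) = - 2 * complex.Re al.
    by case: (al) => u v /=; ring.
  have ImE : complex.Im (- (2 * al)) = - 2 * complex.Im al.
    by case: (al) => u v /=; ring.
  have hz : -1 / 2 <= complex.Re (- (2 * al)) by rewrite ReE; lra.
  have := modulus_excess hz; rewrite ReE ImE => /andP[h1 h2].
  by apply/andP; split; lra.
move: (modulus (1 + al)) (modulus (1 - 2 * al)) key D1 D2 W1 W2 => D W.
move: (complex.Re al) (complex.Im al) nE un un' tE => u v nE un un' tE.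
clearbody n.
move: small n0 nE un un' tE => {al} small n0 nE un un' tE key D1 D2 W1 W2.
(* [s = r - 1/r] with [r] the square root of the modulus of [q], so that
   [s^2] is the left-hand side of the parallelogram identity. *)
pose r := Num.sqrt (modulus q).
have r2 : r ^+ 2 = modulus q by rewrite sqr_sqrtr // modulus_ge0.
have r1 : 1 <= r by rewrite -sqrtr1 ler_wsqrtr.
have r0 : r != 0 by rewrite gt_eqF // (lt_le_trans ltr01).
pose s := r - r^-1.
have rs : r * s = r ^+ 2 - 1 by rewrite /s; field.
have rV : r^-1 <= 1 by rewrite invf_le1 // (lt_le_trans ltr01).
have s0 : 0 <= s by rewrite /s; lra.
have s1 : r - 1 <= s by rewrite /s; lra.
have sD : s ^+ 2 * D = 6 * n + 2 * W - 2 * D.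
  have E : modulus q * (s ^+ 2 * D)
      = (modulus q ^+ 2 + 1) * D - 2 * modulus q * D.
    by rewrite -r2 /s; field.
  move: E; rewrite key => E; apply: (@mulfI _ (modulus q)).
    by rewrite -r2 expf_neq0.
  by rewrite E; ring.
move: (modulus q) q1 key r2 sD => rho q1 key r2 sD.
clearbody r s.
have vn : v ^+ 2 <= n ^+ 2 by nra.
have nn : n ^+ 2 <= n / 4 by nra.
have D34 : 3 / 4 <= D by lra.
(* Here [s ^+ 2 * D <= 6 n - 6 u + 8 v ^+ 2 <= 14 n], and [D >= 3 / 4]. *)
have S20 : s ^+ 2 <= 20 * n by nra.
(* In [s ^+ 2 - t ^+ 2 = (2 W - 2 D + 6 u) - s ^+ 2 * (D - 1)] the terms are at most [8 n ^+ 2] and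
   [25 n ^+ 2] in absolute value, and 33 <= 36. *)
have st : `|s - t| <= 6 * n.
  apply: root_dist_le => //; first by lra.
  have Dn : `|D - 1| <= 5 / 4 * n by rewrite ler_norml; apply/andP; split; lra.
  have sDn : s ^+ 2 * `|D - 1| <= 25 * n ^+ 2.
    have : s ^+ 2 * `|D - 1| <= (20 * n) * (5 / 4 * n).
      by apply: ler_pM => //; exact: sqr_ge0.
    by lra.
  have : `|s ^+ 2 * (D - 1)| <= 25 * n ^+ 2 by rewrite normrM ger0_norm ?sqr_ge0.
  rewrite ler_norml => /andP[g1 g2]; rewrite tE ler_norml.
  by apply/andP; split; lra.
have : 0 <= rho - 1 - s <= s ^+ 2.
  have -> : rho - 1 - s = (r - 1) * s by rewrite -r2 mulrBl rs; ring.
  by rewrite mulr_ge0 ?subr_ge0 // expr2 ler_wpM2r.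
move: st; rewrite ler_norml => /andP[h1 h2] /andP[h3 h4].
by rewrite ler_norml; apply/andP; split; lra.
Qed.

End Asymptotics.

(** * From a bound on [|q|] to bounds on [mu] and [alpha] *)

Section Necessity.
Variable R : realType.

(* The Joukowski map sends [1 <= |q| <= 1 + t] into an ellipse with semi-axes
   at most [1 + t^2 / 2] and [t]. *)
Lemma joukowski_bounds (q m : R[i]) (t : R) : q ^+ 2 - 2 * m * q + 1 = 0 ->
  1 <= modulus q -> modulus q <= 1 + t ->
  modulus m <= 1 + t ^+ 2 / 2 /\ `|complex.Im m| <= t.
Proof.
move=> h q1 qt.
have q0 : q != 0.
  apply/eqP => q0; move: q1; rewrite q0 ComplexField.Normc.normc0.
  by rewrite leNgt ltr01.
have rho0 : 0 < modulus q := lt_le_trans ltr01 q1.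
have mE : 2%:R * m = q + q^-1.
  apply: (mulIf q0); rewrite (mulrDl q) mulVf // -expr2; apply/eqP.
  by rewrite eq_sym -subr_eq0 -h; apply/eqP; ring.
have nV : modulus q^-1 = (modulus q)^-1 := ComplexField.Normc.normcV q.
have rV : (modulus q)^-1 * modulus q = 1 by rewrite mulVf // gt_eqF.
split.
  have : 2 * modulus m <= modulus q + (modulus q)^-1.
    by rewrite -nV -{1}(modulus_natr R 2) -ComplexField.Normc.normcM mE
      modulus_le_add.
  have : 0 < (modulus q)^-1 by rewrite invr_gt0.
  move: (modulus q) (modulus q)^-1 q1 qt rV => r r' q1 qt rV r'0 hm.
  (* As [r * r' = 1], [r + r' - 2 = (r - 1) ^+ 2 * r']. *)
  have : r + r' <= 2 + t ^+ 2 by nra.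
  by lra.
have : complex.Im (2%:R * m) = complex.Im (q + q^-1) by rewrite mE.
have -> : complex.Im (2%:R * m) = 2 * complex.Im m.
  by case: (m) => u v /=; ring.
have -> : complex.Im (q + q^-1) = complex.Im q * (1 - (modulus q)^-1 ^+ 2).
  rewrite exprVn sqr_modulus.
  by case: (q) => u v /=; ring.
have := normIm_le_modulus q; rewrite !ler_norml.
have : 0 < (modulus q)^-1 by rewrite invr_gt0.
move: (complex.Im m) (complex.Im q) => y v.
move: (modulus q) (modulus q)^-1 q1 qt rV => r r' q1 qt rV r'0 /andP[v1 v2] ye.
have r'1 : r' <= 1 by nra.
have d0 : 0 <= 1 - r' ^+ 2 by nra.
have rd : r * (1 - r' ^+ 2) <= 2 * t.
  have -> : r * (1 - r' ^+ 2) = r - r'.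
    by rewrite mulrBr mulr1 expr2 mulrA (mulrC r) rV mul1r.
  by nra.
by apply/andP; split; nra.
Qed.

(** Both bounds divide by [|5 + m| >= 4 - t ^+ 2 / 2]; the 3/8 is 6/16, from
    [Im al = - 6 * Im m / |5 + m| ^+ 2]. *)
Lemma alpha_bounds (al m : R[i]) (t : R) : 0 <= t -> t <= 1 ->
  al * (5 + m) = 1 - m -> modulus m <= 1 + t ^+ 2 / 2 -> `|complex.Im m| <= t ->
  2 * modulus al <= 1 + t ^+ 2
  /\ `|complex.Im al| <= 3 / 8 * t * (1 + t ^+ 2 / 2).
Proof.
move=> t0 t1 alE mt imt.
have P : 4 - t ^+ 2 / 2 <= modulus (5 + m).
  have : modulus (5%:R : R[i]) <= modulus (5 + m) + modulus (- m).
    by apply: le_trans (modulus_le_add _ _); rewrite addrK.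
  by rewrite modulusN modulus_natr; lra.
have tt : t ^+ 2 <= 1 by nra.
split.
  have : modulus al * modulus (5 + m) <= 2 + t ^+ 2 / 2.
    rewrite -ComplexField.Normc.normcM alE.
    apply: le_trans (modulus_le_add _ _) _.
    by rewrite modulusN ComplexField.Normc.normc1; lra.
  move: (modulus al) (modulus_ge0 al) (modulus (5 + m)) P => A A0 P P1 AP.
  have : A * (4 - t ^+ 2 / 2) <= 2 + t ^+ 2 / 2.
    by apply: le_trans AP; rewrite ler_wpM2l.
  by nra.
have E : complex.Im al * modulus (5 + m) ^+ 2 = - 6 * complex.Im m.
  rewrite sqr_modulus; move: alE; clear P mt imt; case: al m => u v [y z].
  have -> : 5 + (y +i* z) = (5 + y) +i* z.
    by apply/eqP; rewrite eq_complex /=; apply/andP; split; apply/eqP; ring.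
  move=> [Re1 Im1] /=.
  (* This is the imaginary part of [1 - m] times the conjugate of [5 + m]. *)
  have -> : v * ((5 + y) ^+ 2 + z ^+ 2)
      = (5 + y) * (u * z + v * (5 + y)) - z * (u * (5 + y) - v * z) by ring.
  by rewrite Re1 Im1; ring.
have : `|complex.Im al| * modulus (5 + m) ^+ 2 <= 6 * t.
  rewrite -[X in _ * X](ger0_norm (sqr_ge0 _)) -normrM E normrM normrN.
  by rewrite (ger0_norm (ler0n _ 6)); lra.
have : (4 - t ^+ 2 / 2) ^+ 2 <= modulus (5 + m) ^+ 2.
  by rewrite ler_pXn2r ?nnegrE ?modulus_ge0 //; lra.
move: (modulus (5 + m) ^+ 2) `|complex.Im al| (normr_ge0 (complex.Im al)).
move=> Q v v0 QP vQ.
have vP : v * (4 - t ^+ 2 / 2) ^+ 2 <= 6 * t.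
  by apply: le_trans vQ; rewrite ler_wpM2l.
have d0 : 0 <= t ^+ 2 / 2 by nra.
have d1 : t ^+ 2 / 2 <= 1 / 2 by lra.
move: (t ^+ 2 / 2) d0 d1 vP {QP vQ P mt tt} => d d0 d1 vP.
(* This replaces [1 / (4 - d) ^+ 2] by the larger [(1 + d) / 16]. *)
have d16 : 16 <= (1 + d) * (4 - d) ^+ 2 by nra.
have : v * 16 <= (1 + d) * (6 * t).
  apply: (@le_trans _ _ (v * ((1 + d) * (4 - d) ^+ 2))).
    by rewrite ler_wpM2l.
  by rewrite mulrCA ler_wpM2l //; lra.
by lra.
Qed.

End Necessity.

(** * Explicit constants for both claims *)

Theorem proposition2 (R : realType) :
  (forall a : R, 0 < a ->
    exists K delta : R, 0 < delta /\
      forall (X : R) (N : nat) (x : nat -> R) (tau : R) (lambda q : R[i]),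
        0 < X -> is_mesh X N x -> mesh_eigenvalue N x lambda ->
        0 < tau -> alpha a tau lambda <> -1 ->
        char_root a tau lambda q -> 1 <= modulus q ->
        tau ^+ 2 * modulus lambda <= delta ->
        `| modulus q - (1 + kappa0 a lambda * tau) |
          <= K * (tau ^+ 2 * modulus lambda))
  /\
  (forall kappa : R, 0 <= kappa ->
    exists K tau0 : R, 0 < tau0 /\
      forall (a X : R) (N : nat) (x : nat -> R) (tau : R)
             (nrm nrm1 : 'rV[R[i]]_N.+1 -> R),
        0 < a -> 0 < X -> is_mesh X N x -> 0 < tau -> tau <= tau0 ->
        is_norm nrm -> is_norm nrm1 ->
        (exists C : R, 0 < C /\ stability_bound x a tau kappa nrm nrm1 C) ->
        forall lambda : R[i],
          mesh_eigenvalue N x lambda -> alpha a tau lambda <> -1 ->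
          1 / 6 * a ^+ 2 * tau ^+ 2
            * Num.max `|complex.Re lambda| (2 * `|complex.Im lambda|)
              <= 1 + K * tau
          /\ a ^+ 2 * `|complex.Im lambda| * tau <= 9 / 2 * kappa + K * tau).
Proof.
split=> [a a0|kappa k0].
  have a2 : 0 < a ^+ 2 by rewrite exprn_gt0.
  (* As [|alpha| = tau ^+ 2 * a ^+ 2 * |lambda| / 12], this [delta] means [|alpha| <= 1 / 4]. *)
  exists (26 / 12 * a ^+ 2), (3 / a ^+ 2); split; first by rewrite divr_gt0.
  move=> X N x tau lambda q _ _ _ tau0 al1 hq q1; rewrite ler_pdivlMr // => small.
  have := char_root_modulus_asymptotic a0 tau0 al1 hq q1.
  rewrite modulus_alpha => /(_ _) h; apply: le_trans (h _) _; first by lra.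
  by rewrite le_eqVlt; apply/orP; left; apply/eqP; ring.
(* This [tau0] gives [kappa * tau <= 1], also for [kappa = 0]. In [K], [3 * kappa] serves the first
   condition and [9 / 4 * kappa ^+ 2] the second. *)
exists (3 * kappa + 9 / 4 * kappa ^+ 2), (1 + kappa)^-1.
split; first by rewrite invr_gt0 ltr_wpDr.
move=> a X N x tau nrm nrm1 a0 _ _ tau0 tauk nN _ [C [_ stab]] lambda ev al1.
have [q hq q1] := char_root_exists a tau lambda.
have qt := char_root_le_growth tau0 k0 nN stab ev al1 hq.
have [mt imt] := joukowski_bounds hq q1 qt.
have t0 : 0 <= kappa * tau by rewrite mulr_ge0 // ltW.
have t1 : kappa * tau <= 1.
  move: tauk; rewrite -[(1 + kappa)^-1]mul1r ler_pdivlMr ?ltr_wpDr // => h.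
  by lra.
have alE : alpha a tau lambda * (5 + mu a tau lambda) = 1 - mu a tau lambda.
  rewrite /mu; field.
  by rewrite addrC addr_eq0; apply/eqP.
have [] := alpha_bounds t0 t1 alE mt imt.
have := normRe_le_modulus (alpha a tau lambda).
have c0 := alpha_scale_ge0 a tau.
have -> : complex.Re (alpha a tau lambda)
    = 12^-1 * tau ^+ 2 * a ^+ 2 * complex.Re lambda.
  by rewrite /alpha; case: (lambda) => u v /=; ring.
have -> : complex.Im (alpha a tau lambda)
    = 12^-1 * tau ^+ 2 * a ^+ 2 * complex.Im lambda.
  by rewrite /alpha; case: (lambda) => u v /=; ring.
rewrite !(normrM (12^-1 * tau ^+ 2 * a ^+ 2)) !(ger0_norm c0).
move: (modulus _) `|complex.Re _| `|complex.Im _| => n u v un n1 v1.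
have tt : (kappa * tau) ^+ 2 <= kappa * tau by rewrite expr2 ler_piMl.
have pos : 0 <= kappa ^+ 2 * tau by rewrite mulr_ge0 ?sqr_ge0 // ltW.
split.
  (* The two entries become [2 * |Re alpha|] and [4 * |Im alpha|]. *)
  rewrite maxr_pMr; last by rewrite mulr_ge0 ?sqr_ge0 // mulr_ge0 ?sqr_ge0 //; lra.
  rewrite ge_max; apply/andP; split; first by lra.
  have : 3 / 8 * (kappa * tau) * (1 + (kappa * tau) ^+ 2 / 2)
      <= 3 / 8 * (kappa * tau) * 2.
    by rewrite ler_wpM2l //; lra.
  by lra.
(* After multiplication by [tau] the left side is [12 * |Im alpha|], and 12 * 3/8 = 9/2. *)
rewrite -(ler_pM2r tau0).
have : 3 / 8 * (kappa * tau) * (1 + (kappa * tau) ^+ 2 / 2)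
    <= 3 / 8 * (kappa * tau) * (1 + kappa * tau / 2).
  by rewrite ler_wpM2l //; lra.
have : 0 <= kappa * tau ^+ 2 by rewrite mulr_ge0 ?sqr_ge0.
by lra.
Qed.
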